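(* Consider Algorithm IRETR run with $\gamma=1$ and accuracy level $\varepsilon_g>0$. Assume that: (1) $h:\mathbb N\to\mathbb R$ is monotone, strictly decreasing, with $h(1)>0$ and $h(N)=0$; put $\underline h=h(N-1)$; (2) $\{x_k\}\subset\Omega$ for some compact set $\Omega\subset\mathbb R^n$; (3) the gradients $\nabla\phi_i$, $1\le i\le N$, are Lipschitz continuous, with a common constant $L$, on the segments $[x_k,x_k+p_k]$ for all $k\ge0$ and all trial steps $p_k$ generated in the repetitions of Steps 2--5; (4) there is $\kappa_B>0$ such that $\|B_{k+1}\|\le\kappa_B$ for all $k$. Suppose further that $\underline h^{-1}=\mathcal O(\varepsilon_g^{-2})$ and that $\Delta_0$ is independent of $\varepsilon_g$ and satisfies $\Delta_0\ge\zeta_1\max\{\Gamma\varepsilon_g,\sqrt{\underline h/\mu}\}$. Let $\nu_4>0$ be a constant independent of $\varepsilon_g$ such that Algorithm IRETR needs at most $\lceil\nu_4\varepsilon_g^{-2}\rceil+1$ iterations. Then there exists a constant $\nu_5$ (independent of $\varepsilon_g$) such that Algorithm IRETR needs at most $$\left\lceil\nu_4\,\varepsilon_g^{-2}\left(1-\frac{\log\zeta_2}{\log\zeta_1}\right)-\frac{\log(\nu_5\,\varepsilon_g^{-1})}{\log\zeta_1}\right\rceil$$ function evaluations.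
   Context: Problem. Let $N,n\ge 1$ be integers and $\phi_1,\dots,\phi_N:\mathbb R^n\to\mathbb R$ continuously differentiable. For a nonempty $I_M\subseteq\{1,\dots,N\}$ with $|I_M|=M$ put $f_M(x)=\frac1M\sum_{i\in I_M}\phi_i(x)$; $f_N$ is the full average, to be minimized over $\mathbb R^n$. $\|\cdot\|$ is the Euclidean (operator 2-) norm. $h:\mathbb N\to\mathbb R$ measures infeasibility with respect to the constraint $M=N$. Algorithm IRETR. Data: $x_0\in\mathbb R^n$, an integer $N_0\in(0,N]$, $\theta_0\in(0,1)$, $\Delta_0>0$, $0<\zeta_1<1<\zeta_2$, $\gamma\in(0,1]$, $r,\eta,\tau\in(0,1)$, $\mu\in[0,1)$, $\varepsilon_g\ge0$. Step 0. Set $k=0$, $\mathcal T_0=0$, $\Delta_0^{(0)}=\Delta_0$. Step 1. If $N_k<N$, find an integer $\widetilde N_{k+1}$ with $N_k<\widetilde N_{k+1}\le N$ and $h(\widetilde N_{k+1})\le r\,h(N_k)$. If $N_k=N$, set $\widetilde N_{k+1}=N$. Step 2. Choose an integer $1\le N_{k+1}\le\widetilde N_{k+1}$ with $h(N_{k+1})-h(\widetilde N_{k+1})\le\mu(\Delta_k^{(\mathcal T_k)})^{1+\gamma}$ and a sample $I_{N_{k+1}}$. If $N_k=N$ and $\|\nabla f_{N_{k+1}}(x_k)\|\le\varepsilon_g$, stop. Build the model $m_k(p)=f_{N_{k+1}}(x_k)+\nabla f_{N_{k+1}}(x_k)^Tp+\frac12p^TB_{k+1}p$ with $B_{k+1}\in\mathbb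 R^{n\times n}$ symmetric (possibly zero). Find $p_k$ with $\|p_k\|\le\Delta_k^{(\mathcal T_k)}$ and $m_k(0)-m_k(p_k)\ge\tau(m_k(0)-m_k(p_k^C))$, where the Cauchy step $p_k^C$ minimizes $m_k$ over $\{p=-t\nabla f_{N_{k+1}}(x_k):\ t>0,\ \|p\|\le\Delta_k^{(\mathcal T_k)}\}$. Step 3. If $N_k=N$, $N_{k+1}<N$ and $f_N(x_k)-m_k(p_k)<\tau(m_k(0)-m_k(p_k^C))$, set $\Delta_k^{(\mathcal T_k+1)}=\zeta_1\Delta_k^{(\mathcal T_k)}$, $\mathcal T_k=\mathcal T_k+1$ and repeat Step 2. Step 4. Set $\theta_{k+1}=\theta_k$ if $\mathrm{Pred}_k(\theta_k)\ge\eta(h(N_k)-h(\widetilde N_{k+1}))$; otherwise $\theta_{k+1}=\dfrac{(1-\eta)(h(N_k)-h(\widetilde N_{k+1}))}{m_k(p_k)-f_{N_k}(x_k)+h(N_k)-h(\widetilde N_{k+1})}$. Step 5. If $\mathrm{Ared}_k(\theta_{k+1})\ge\eta\,\mathrm{Pred}_k(\theta_{k+1})$, set $x_{k+1}=x_k+p_k$, $\Delta_k=\Delta_k^{(\mathcal T_k)}$, choose $\Delta_{k+1}^{(0)}\in[\Delta_k,\zeta_2\Delta_k]$, set $k=k+1$, $\mathcal T_k=0$ and go to Step 1. Otherwise set $\Delta_k^{(\mathcal T_k+1)}=\zeta_1\Delta_k^{(\mathcal T_k)}$, $\mathcal T_k=\mathcal T_k+1$ and go to Step 2. Here $\mathrm{Pred}_k(\theta)=\theta(f_{N_k}(x_k)-m_k(p_k))+(1-\theta)(h(N_k)-h(\widetilde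 N_{k+1}))$ and $\mathrm{Ared}_k(\theta)=\theta(f_{N_k}(x_k)-f_{N_{k+1}}(x_k+p_k))+(1-\theta)(h(N_k)-h(N_{k+1}))$. Iterations are counted by $k$, including the final iteration at which the stopping test holds; $\mathcal T_k$ is the number of trust-region reductions in iteration $k$. Counting. A function evaluation is the evaluation of a (possibly subsampled) function $f_M$, $M\le N$, at a trial point $x_k+p_k$; each iteration requires one, plus one for each trust-region reduction, so the total is $\sum_k(1+\mathcal T_k)$ over the iterations performed. Constants. $\underline\theta>0$ is a constant with $\underline\theta\le\theta_k$ for all $k$ (such a constant exists under the assumptions); $\kappa_T=L+\kappa_B/2$; $\beta=1+\kappa_B$. $\Gamma$ is a positive constant, not depending on $k$ or $\varepsilon_g$, with $\Gamma\le\min\{1/\beta,\ \tau\underline\theta(1-\eta)/(2(\kappa_T+\mu))\}$, such that $\Delta_k\ge\min\{\zeta_1\sqrt{\underline h/\mu},\ \zeta_1\Gamma\varepsilon_g,\ \Delta_0\}$ at termination of every iteration $k$ with $N_k=N$ whose accepted $N_{k+1}$ satisfies $\|\nabla f_{N_{k+1}}(x_k)\|>\varepsilon_g$. The hypothesis $\underline h^{-1}=\mathcal O(\varepsilon_g^{-2})$ means $\underline h^{-1}\le C\varepsilon_g^{-2}$ for a constant $C$ independent of $\varepsilon_g$. *)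

(* Defs.v *)
From HB Require Import structures.
From mathcomp Require Export all_boot all_order all_algebra.
From mathcomp Require Export all_classical all_reals all_analysis.
Export Order.TTheory GRing.Theory Num.Theory numFieldNormedType.Exports.

Set Implicit Arguments.
Unset Strict Implicit.
Unset Printing Implicit Defensive.

Local Open Scope classical_set_scope.
Local Open Scope ring_scope.

Section Euclidean.
Context {R : realType} {n : nat}.

Definition dot (u v : 'cV[R]_n) : R := (u^T *m v) 0 0.

(* The norm `|u| of the library on matrices is the max norm. *)
Definition enorm (u : 'cV[R]_n) : R := Num.sqrt (dot u u).

Definition opnorm (B : 'M[R]_n) : R :=
  sup [set enorm (B *m u) | u in [set u | enorm u <= 1]].

Definition gradient (f : 'cV[R]_n -> R) (x : 'cV[R]_n) : 'cV[R]_n :=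
  \col_i 'D_(delta_mx i 0) f x.

Definition C1 (f : 'cV[R]_n -> R) : Prop :=
  (forall x, differentiable f x) /\ continuous (gradient f).

Definition segment (x y : 'cV[R]_n) : set 'cV[R]_n :=
  [set x + t *: (y - x) | t in [set t : R | 0 <= t <= 1]].

Definition elipschitz_on (L : R) (A : set 'cV[R]_n)
    (g : 'cV[R]_n -> 'cV[R]_n) : Prop :=
  forall y z, A y -> A z -> enorm (g y - g z) <= L * enorm (y - z).

Definition quad_model (c : R) (g : 'cV[R]_n) (B : 'M[R]_n) (p : 'cV[R]_n) : R :=
  c + dot g p + 2^-1 * dot p (B *m p).

Definition cauchy_arc (g : 'cV[R]_n) (D : R) : set 'cV[R]_n :=
  [set p | (exists2 t, 0 < t & p = - t *: g) /\ enorm p <= D].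

Definition is_cauchy_step (m : 'cV[R]_n -> R) (g : 'cV[R]_n) (D : R)
    (pC : 'cV[R]_n) : Prop :=
  cauchy_arc g D pC /\ forall p, cauchy_arc g D p -> m pC <= m p.

End Euclidean.

Record iretr_data (R : realType) (n : nat) := IretrData {
  x0 : 'cV[R]_n;
  N0 : nat;
  theta0 : R;
  Delta0 : R;
  zeta1 : R;
  zeta2 : R;
  gamma : R;
  r : R;
  eta : R;
  tau : R;
  mu : R }.

Definition valid_data (R : realType) (n N : nat) (d : iretr_data R n) : Prop :=
  (0 < N0 d <= N)%N /\ 0 < theta0 d < 1 /\ 0 < Delta0 d /\
  0 < zeta1 d < 1 /\ 1 < zeta2 d /\ 0 < gamma d <= 1 /\ 0 < r d < 1 /\
  0 < eta d < 1 /\ 0 < tau d < 1 /\ 0 <= mu d < 1.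

(* The choices of one pass through Step 2 of iteration k: the sample
   I_{N_{k+1}}, the matrix B_{k+1}, the step p_k and the Cauchy step p_k^C. *)
Record trial (R : realType) (n N : nat) := Trial {
  tI : {set 'I_N};
  tB : 'M[R]_n;
  tp : 'cV[R]_n;
  tpC : 'cV[R]_n }.

(* An execution of the algorithm, possibly interrupted: iterations
   0, ..., lastit - 1 are complete, iteration k having undergone T k radius
   reductions, and iteration lastit has undergone T lastit reductions so far and
   is at the beginning of Step 2.  A terminated execution is the case where that
   last pass through Step 2 meets the stopping test.  A bound that holds for all
   such executions, terminated or not, rules out infinite executions.
   xs k, Is k, Nt k, th k and Del k j stand for x_k, I_{N_k}, \tilde N_k,
   theta_k and Delta_k^{(j)}; thus N_k is #|Is k|.  The values at 0 of Nt, and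
   those of all sequences beyond the point of interruption, are irrelevant. *)
Record execution (R : realType) (n N : nat) := Execution {
  xs : nat -> 'cV[R]_n;
  Is : nat -> {set 'I_N};
  Nt : nat -> nat;
  th : nat -> R;
  Del : nat -> nat -> R;
  T : nat -> nat;
  trials : nat -> nat -> trial R n N;
  lastit : nat }.

Definition favg (R : realType) (n N : nat) (phi : 'I_N -> 'cV[R]_n -> R)
    (S : {set 'I_N}) (x : 'cV[R]_n) : R :=
  #|S|%:R^-1 * \sum_(i in S) phi i x.

Section Algorithm.
Context {R : realType} {n N : nat}.
Variables (phi : 'I_N -> 'cV[R]_n -> R) (d : iretr_data R n).
Variables (eps : R) (h : nat -> R) (e : execution R n N).

Section Pass.
Variables k j : nat.

Let t := trials e k j.
Let x := xs e k.
Let Nk := #|Is e k|.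
Let Nk1 := #|tI t|.
Let Ntk1 := Nt e k.+1.
Let fk := favg phi (Is e k).
Let fk1 := favg phi (tI t).
Let D := Del e k j.

Definition model : 'cV[R]_n -> R :=
  quad_model (fk1 x) (gradient fk1 x) (tB t).

Definition Pred (theta : R) : R :=
  theta * (fk x - model (tp t)) + (1 - theta) * (h Nk - h Ntk1).

Definition Ared (theta : R) : R :=
  theta * (fk x - fk1 (x + tp t)) + (1 - theta) * (h Nk - h Nk1).

Definition step1 : Prop :=
  if (Nk < N)%N then (Nk < Ntk1 <= N)%N /\ h Ntk1 <= r d * h Nk
  else Ntk1 = N.

Definition step2 : Prop :=
  (1 <= Nk1 <= Ntk1)%N /\
  h Nk1 - h Ntk1 <= mu d * D `^ (1 + gamma d) /\
  ~ (Nk = N /\ enorm (gradient fk1 x) <= eps) /\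
  (tB t)^T = tB t /\
  is_cauchy_step model (gradient fk1 x) D (tpC t) /\
  enorm (tp t) <= D /\
  model 0 - model (tp t) >= tau d * (model 0 - model (tpC t)).

Definition step3_reduces : Prop :=
  Nk = N /\ (Nk1 < N)%N /\
  favg phi [set: 'I_N] x - model (tp t) < tau d * (model 0 - model (tpC t)).

Definition theta_next : R :=
  if Pred (th e k) >= eta d * (h Nk - h Ntk1) then th e k
  else (1 - eta d) * (h Nk - h Ntk1)
       / (model (tp t) - fk x + h Nk - h Ntk1).

Definition accepted : Prop :=
  ~ step3_reduces /\ Ared theta_next >= eta d * Pred theta_next.

(* Pass j of iteration k has been carried out without meeting the stopping
   test. *)
Definition performed : bool :=
  ((k < lastit e) && (j <= T e k) || (k == lastit e) && (j < T e k))%N.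

End Pass.

Definition is_execution : Prop :=
  (xs e 0 = x0 d /\ #|Is e 0| = N0 d /\ th e 0 = theta0 d /\
   Del e 0 0 = Delta0 d) /\
  (forall k, (k <= lastit e)%N -> step1 k) /\
  (forall k j, performed k j -> step2 k j) /\
  (forall k j, (k <= lastit e)%N -> (j < T e k)%N ->
     ~ accepted k j /\ Del e k j.+1 = zeta1 d * Del e k j) /\
  (forall k, (k < lastit e)%N ->
     accepted k (T e k) /\
     xs e k.+1 = xs e k + tp (trials e k (T e k)) /\
     Is e k.+1 = tI (trials e k (T e k)) /\
     th e k.+1 = theta_next k (T e k) /\
     Del e k (T e k) <= Del e k.+1 0 <= zeta2 d * Del e k (T e k)).

Definition iterations : nat := (lastit e).+1.

(* The pass at which the execution ends or is interrupted counts for one. *)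
Definition evaluations : nat := \sum_(k < (lastit e).+1) (1 + T e k)%N.

End Algorithm.

(* Main.v *)
Require Import Defs.
From mathcomp Require Import ring lra.

(** A pass rejected in Step 3 or Step 5 can only have a radius of order at least
    [eps].  When N_k < N, restoration predicts a decrease of at least
    (1 - r) h(N-1), which is of order [eps ^+ 2] because 1/h(N-1) = O(eps^-2),
    while the actual and predicted decreases differ by O(radius^2).  When
    N_k = N, a radius small against sqrt(h(N-1)) forces N_{k+1} = N, so that
    Step 3 cannot reduce it, and the failed stopping test makes the Cauchy
    decrease at least radius * eps / 2, which again beats an O(radius^2) error.
    Hence every radius, including those of the unfinished last iteration, is at
    least c * eps.  Each reduction multiplies the radius by zeta1 and each
    iteration by at most zeta2, so with S reductions over K completed iterations
    c * eps <= zeta2^K * zeta1^S * Delta0; taking logarithms bounds S. *)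

Set Implicit Arguments.
Unset Strict Implicit.
Unset Printing Implicit Defensive.

Local Open Scope classical_set_scope.
Local Open Scope ring_scope.

(** * Euclidean inequalities, the operator norm, and descent along a segment *)

Section EuclideanLemmas.
Context {R : realType} {n : nat}.
Implicit Types (u v w p x : 'cV[R]_n) (B : 'M[R]_n) (f : 'cV[R]_n -> R).

Lemma dotE u v : dot u v = \sum_i u i 0 * v i 0.
Proof. by rewrite /dot mxE; apply: eq_bigr => i _; rewrite mxE. Qed.

Lemma dotC u v : dot u v = dot v u.
Proof. by rewrite !dotE; apply: eq_bigr => i _; rewrite mulrC. Qed.

Lemma dotDr u v w : dot u (v + w) = dot u v + dot u w.
Proof. by rewrite /dot mulmxDr mxE. Qed.

Lemma dotZr a u v : dot u (a *: v) = a * dot u v.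
Proof. by rewrite /dot -scalemxAr mxE. Qed.

Lemma dot0r u : dot u 0 = 0.
Proof. by rewrite /dot mulmx0 mxE. Qed.

Lemma dotDl u v w : dot (u + v) w = dot u w + dot v w.
Proof. by rewrite dotC dotDr !(dotC w). Qed.

Lemma dotZl a u v : dot (a *: u) v = a * dot u v.
Proof. by rewrite dotC dotZr dotC. Qed.

Lemma dot_ge0 u : 0 <= dot u u.
Proof. by rewrite dotE; apply: sumr_ge0 => i _; rewrite -expr2 sqr_ge0. Qed.

Lemma dot_eq0 u : dot u u = 0 -> u = 0.
Proof.
rewrite dotE => /eqP; rewrite psumr_eq0 => [/allP u0|i _]; last first.
  by rewrite -expr2 sqr_ge0.
apply/matrixP => i j; rewrite ord1 mxE; apply/eqP.
by have := u0 i (mem_index_enum i); rewrite /= mulf_eq0 orbb.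
Qed.

Lemma enorm_ge0 u : 0 <= enorm u.
Proof. exact: sqrtr_ge0. Qed.

Lemma sqr_enorm u : enorm u ^+ 2 = dot u u.
Proof. by rewrite sqr_sqrtr ?dot_ge0. Qed.

Lemma enorm_eq0 u : enorm u = 0 -> u = 0.
Proof. by move=> u0; apply: dot_eq0; rewrite -sqr_enorm u0 expr0n. Qed.

Lemma enormZ a u : enorm (a *: u) = `|a| * enorm u.
Proof.
by rewrite /enorm dotZl dotZr mulrA -expr2 sqrtrM ?sqr_ge0 ?sqrtr_sqr.
Qed.

(** Cauchy-Schwarz: expand the nonnegative squared norm of |v| u - |u| v and cancel the factor |u|
    |v|. *)
Lemma dot_le_enorm u v : dot u v <= enorm u * enorm v.
Proof.
have [u0|u_neq0] := eqVneq (enorm u) 0.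
  by rewrite u0 mul0r (enorm_eq0 u0) dotC dot0r.
have [v0|v_neq0] := eqVneq (enorm v) 0.
  by rewrite v0 mulr0 (enorm_eq0 v0) dot0r.
have := dot_ge0 (enorm v *: u + - enorm u *: v).
rewrite !(dotDl, dotDr, dotZl, dotZr) (dotC v u) -!sqr_enorm => le0.
have uv_gt0 : 0 < enorm u * enorm v.
  by rewrite mulr_gt0 // lt0r enorm_ge0 ?u_neq0 ?v_neq0.
rewrite -(ler_pM2l uv_gt0); lra.
Qed.

Lemma normr_dot_le u v : `|dot u v| <= enorm u * enorm v.
Proof.
rewrite ler_norml dot_le_enorm andbT lerNl.
by have := dot_le_enorm (- 1 *: u) v; rewrite dotZl enormZ normrN1 mul1r mulN1r.
Qed.

(** Without an upper bound the [sup] in [opnorm] would be a default value. The Frobenius norm of [B]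
    is such a bound, by Cauchy-Schwarz on each row. *)
Lemma enorm_mulmx_bounded B :
  has_ubound [set enorm (B *m u) | u in [set u | enorm u <= 1]].
Proof.
pose b i := (row i B)^T.
exists (Num.sqrt (\sum_i dot (b i) (b i))) => _ [u /= u1 <-].
rewrite /enorm ler_sqrt; last by apply: sumr_ge0 => i _; apply: dot_ge0.
rewrite dotE; apply: ler_sum => i _.
have -> : (B *m u) i 0 = dot (b i) u.
  by rewrite dotE !mxE; apply: eq_bigr => j _; rewrite !mxE.
rewrite -expr2 -real_normK ?num_real // -[dot (b i) (b i)]sqr_enorm lerXn2r //.
- by rewrite nnegrE enorm_ge0.
- by rewrite (le_trans (normr_dot_le _ _))// ler_piMr ?enorm_ge0.
Qed.

Lemma enorm_mulmx_le B u : enorm (B *m u) <= opnorm B * enorm u.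
Proof.
have [u0|u_neq0] := eqVneq (enorm u) 0.
  by rewrite u0 mulr0 (enorm_eq0 u0) mulmx0 /enorm dot0r sqrtr0.
have u_gt0 : 0 < enorm u by rewrite lt0r u_neq0 enorm_ge0.
rewrite -ler_pdivrMr //.
have -> : enorm (B *m u) / enorm u = enorm (B *m ((enorm u)^-1 *: u)).
  by rewrite -scalemxAr enormZ ger0_norm ?invr_ge0 ?enorm_ge0 // mulrC.
apply: ub_le_sup; first exact: enorm_mulmx_bounded.
exists ((enorm u)^-1 *: u) => //=.
by rewrite enormZ ger0_norm ?invr_ge0 ?enorm_ge0 // mulVf.
Qed.

Lemma normr_quad_form_le B u : `|dot u (B *m u)| <= opnorm B * enorm u ^+ 2.
Proof.
rewrite (le_trans (normr_dot_le _ _))// expr2 mulrCA.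
by rewrite ler_wpM2l ?enorm_ge0 ?enorm_mulmx_le.
Qed.

Lemma derive_dot_gradient f x v :
  differentiable f x -> 'D_v f x = dot (gradient f x) v.
Proof.
move=> df; rewrite deriveE // {1}[v]matrix_sum_delta linear_sum dotE.
apply: eq_bigr => i _; rewrite big_ord1 linearZ /= mxE deriveE //.
by rewrite mulrC.
Qed.

(** The difference quotient of s |-> f (x + s p) at [t] is the directional quotient of [f] at x + t
    p along [p], so no chain rule is involved. *)
Lemma derive_along_line f x p t : (forall y, differentiable f y) ->
  is_derive t (1 : R) (fun s : R => f (x + s *: p))
    (dot (gradient f (x + t *: p)) p).
Proof.
move=> df; have dfp : derivable f (x + t *: p) p by exact/diff_derivable.
have quotE : (fun a : R => a^-1 *: (((fun s : R => f (x + s *: p)) \o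
      shift t) (a *: 1) - f (x + t *: p))) =
    (fun a : R => a^-1 *: ((f \o shift (x + t *: p)) (a *: p)
      - f (x + t *: p))).
  apply/funext => a /=; congr (_ *: (f _ - _)).
  by rewrite [a *: 1]mulr1 scalerDl addrCA.
split; first by rewrite /derivable quotE.
by rewrite -derive_dot_gradient // /derive quotE.
Qed.

(* The mean value theorem gives this with L in place of the optimal L / 2. *)
Lemma descent f L x p : (forall y, differentiable f y) ->
  0 <= L -> elipschitz_on L (segment x (x + p)) (gradient f) ->
  f (x + p) - f x - dot (gradient f x) p <= L * enorm p ^+ 2.
Proof.
move=> df L0 lip.
have dline t : is_derive t (1 : R) (fun s : R => f (x + s *: p)) _ :=
  derive_along_line x p t df.
have cont : {within `[(0 : R), 1], continuous (fun s : R => f (x + s *: p))}.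
  apply: derivable_within_continuous => t _.
  by have [] := dline t.
have [t /=] := MVT ltr01 (fun t _ => dline t) cont.
rewrite in_itv /= => /andP[t0 t1].
rewrite scale0r addr0 scale1r subr0 mulr1 => ->.
have -> : dot (gradient f (x + t *: p)) p - dot (gradient f x) p =
    dot (gradient f (x + t *: p) - gradient f x) p.
  by rewrite dotDl -[- gradient f x]scaleN1r dotZl mulN1r.
rewrite (le_trans (dot_le_enorm _ _))// expr2 mulrA.
rewrite ler_wpM2r ?enorm_ge0 //.
have seg s : 0 <= s <= 1 -> segment x (x + p) (x + s *: p).
  by move=> s01; exists s => //; rewrite addrAC subrr add0r.
have := lip (x + t *: p) (x + 0 *: p) (seg _ _) (seg _ _).
rewrite scale0r addr0 [x + _ - x]addrAC subrr add0r enormZ gtr0_norm // => le.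
rewrite (le_trans (le _ _)) ?lexx ?ler01 ?(ltW t0) ?(ltW t1) //.
by rewrite ler_wpM2l // ler_piMl ?enorm_ge0 ?ltW.
Qed.

End EuclideanLemmas.

(** * Subsampled averages and their quadratic models *)

Section ModelLemmas.
Context {R : realType} {n N : nat}.
Implicit Types (x p pC g : 'cV[R]_n) (B : 'M[R]_n) (S : {set 'I_N}).
Context (phi : 'I_N -> 'cV[R]_n -> R).
Context (dphi : forall i x, differentiable (phi i) x).

Lemma dot_gradient_favg S x p :
  dot (gradient (favg phi S) x) p =
    #|S|%:R^-1 * \sum_(i in S) dot (gradient (phi i) x) p.
Proof.
(* Summing over all indices, with the zero function off [S], lets the differentiation rules for
   finite sums apply. *)
have favgE : favg phi S =
    #|S|%:R^-1 \*: \sum_(i < N) (if i \in S then phi i else cst 0).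
  apply/funext => y; rewrite /favg big_mkcond /= fct_sumE.
  by congr (_ * _); apply: eq_bigr => i _; case: ifP.
have dsum (i : 'I_N) : differentiable (if i \in S then phi i else cst 0) x.
  by case: ifP => // _; exact: differentiable_cst.
rewrite -derive_dot_gradient favgE; last first.
  exact/differentiableZ/differentiable_sum.
rewrite deriveZ; last by apply: derivable_sum => i; exact/diff_derivable.
rewrite derive_sum => [|i]; last exact/diff_derivable.
congr (_ * _); rewrite [RHS]big_mkcond; apply: eq_bigr => i _.
by case: ifP => _; rewrite ?derive_cst // derive_dot_gradient.
Qed.

Lemma descent_favg S L x p : 0 <= L ->
  (forall i, elipschitz_on L (segment x (x + p)) (gradient (phi i))) ->
  favg phi S (x + p) - favg phi S x - dot (gradient (favg phi S) x) p <=
    L * enorm p ^+ 2.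
Proof.
move=> L0 lip; rewrite dot_gradient_favg /favg -!mulrBr -!sumrB.
(* For an empty sample the inverse of 0 is 0, so the left side vanishes. *)
have [->|S_neq0] := eqVneq #|S| 0%N.
  by rewrite invr0 mul0r mulr_ge0 ?sqr_ge0.
rewrite ler_pdivrMl ?ltr0n ?lt0n // mulr_natl -sumr_const.
by apply: ler_sum => i _; apply: descent.
Qed.

(** Descent contributes [L] and the quadratic term of the model at most [kappa / 2]. An upper bound
    is enough: only a function value above the model can spoil acceptance. *)
Lemma model_error S L kappa B x p : 0 <= L -> opnorm B <= kappa ->
  (forall i, elipschitz_on L (segment x (x + p)) (gradient (phi i))) ->
  favg phi S (x + p) -
    quad_model (favg phi S x) (gradient (favg phi S) x) B p <=
    (L + kappa / 2) * enorm p ^+ 2.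
Proof.
move=> L0 Bk lip; have := descent_favg S L0 lip.
have := normr_quad_form_le B p; rewrite ler_norml => /andP[qB _].
have : opnorm B * enorm p ^+ 2 <= kappa * enorm p ^+ 2.
  by rewrite ler_wpM2r ?sqr_ge0.
rewrite /quad_model; lra.
Qed.

Lemma quad_model0 c g B : quad_model c g B 0 = c.
Proof. by rewrite /quad_model mulmx0 !dot0r mulr0 !addr0. Qed.

(* Below the radius `|g| / (1 + kappa) the linear term dominates on the whole
   arc, so the trial step to the boundary realizes half the linear decrease. *)
Lemma cauchy_decrease c g B D kappa pC : opnorm B <= kappa ->
  0 < D -> D * (1 + kappa) <= enorm g ->
  is_cauchy_step (quad_model c g B) g D pC ->
  D * enorm g / 2 <= c - quad_model c g B pC.
Proof.
move=> Bk D0 Dg [_ pCmin].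
have k0 : 0 <= kappa.
  apply: le_trans Bk; apply: ub_le_sup; first exact: enorm_mulmx_bounded.
  exists 0; last by rewrite mulmx0 /enorm dot0r sqrtr0.
  by rewrite /= /enorm dot0r sqrtr0.
have g0 : 0 < enorm g by rewrite (lt_le_trans _ Dg) // mulr_gt0 //; lra.
pose t := D / enorm g.
have t0 : 0 < t by rewrite divr_gt0.
have tg : t * enorm g = D by rewrite divfK ?gt_eqF.
have arc : cauchy_arc g D (- t *: g).
  by split; [exists t | rewrite enormZ normrN gtr0_norm // tg].
have := pCmin _ arc; rewrite /quad_model.
rewrite -scalemxAr !(dotZl, dotZr) -sqr_enorm.
have := normr_quad_form_le B g; rewrite ler_norml => /andP[_ qB].
have qk : dot g (B *m g) <= kappa * enorm g ^+ 2.
  by rewrite (le_trans qB) // ler_wpM2r ?sqr_ge0.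
have qt : t ^+ 2 * dot g (B *m g) <= kappa * D ^+ 2.
  have -> : kappa * D ^+ 2 = t ^+ 2 * (kappa * enorm g ^+ 2).
    by rewrite -tg exprMn mulrCA.
  by rewrite ler_wpM2l ?sqr_ge0.
have tgg : t * enorm g ^+ 2 = D * enorm g by rewrite expr2 mulrA tg.
have : kappa * D ^+ 2 <= D * enorm g.
  by rewrite expr2 mulrCA ler_wpM2l ?ltW //; lra.
move: qt tgg; lra.
Qed.

End ModelLemmas.

(** An updated parameter solves Pred(theta) = eta (h(N_k) - h(Nt_{k+1})) exactly. Failure of the
    test in Step 4 makes its denominator positive and the quotient smaller than theta_k. *)
Lemma theta_next_bounds (R : realType) (n N : nat)
    (phi : 'I_N -> 'cV[R]_n -> R) (d : iretr_data R n) (h : nat -> R)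
    (e : execution R n N) (k j : nat) (theta' := theta_next phi d h e k j) :
  eta d < 1 -> 0 <= th e k -> h (Nt e k.+1) <= h #|Is e k| ->
  0 <= theta' <= th e k /\
  eta d * (h #|Is e k| - h (Nt e k.+1)) <= Pred phi h e k j theta'.
Proof.
move=> eta1 th0; rewrite {}/theta' /theta_next.
case: ifPn => [le|]; first by rewrite th0 lexx.
rewrite -ltNge /Pred.
set a := h #|_|; set b := h (Nt _ _); set f := favg _ _ _.
set m := model _ _ _ _ _.
move=> lt ab; have ea : 0 <= (1 - eta d) * (a - b).
  by rewrite mulr_ge0 // subr_ge0 // ltW.
have den_lt : (1 - eta d) * (a - b) < th e k * (m - f + a - b) by lra.
have den0 : 0 < m - f + a - b.
  by rewrite ltNge; apply/negP => den; have := mulr_ge0_le0 th0 den; lra.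
split; first by rewrite divr_ge0 ?(ltW den0) //= ler_pdivrMr // ltW.
set den := m - f + a - b in den0 *.
have : (1 - eta d) * (a - b) / den * den = (1 - eta d) * (a - b).
  by rewrite divfK ?gt_eqF.
set q := _ / den; rewrite /den; lra.
Qed.

(** * Bounds on the trust-region radii along an execution *)

Section Radius.
Context {R : realType} {n N : nat} (phi : 'I_N -> 'cV[R]_n -> R).
Context (d : iretr_data R n) (eps : R) (h : nat -> R) (e : execution R n N).
Context (L kappaB theta_low Gamma C : R).
Context (N_ge1 : (1 <= N)%N) (phi_C1 : forall i, C1 (phi i)).
Context (d_valid : valid_data N d) (gamma_eq1 : gamma d = 1).
Context (mu_gt0 : 0 < mu d) (L_ge0 : 0 <= L) (kappaB_gt0 : 0 < kappaB).
Context (theta_low_gt0 : 0 < theta_low) (Gamma_gt0 : 0 < Gamma).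
Context (Gamma_le_beta : Gamma * (1 + kappaB) <= 1).
Context (Gamma_le_theta : Gamma * (2 * (L + kappaB / 2 + mu d)) <=
  tau d * theta_low * (1 - eta d)).
Context (eps_gt0 : 0 < eps) (exec : is_execution phi d eps h e).
Context (h_decr : forall a b : nat, (a < b)%N -> h b < h a) (hN0 : h N = 0).
Context (lip : forall k j, performed e k j -> forall i,
  elipschitz_on L (segment (xs e k) (xs e k + tp (trials e k j)))
    (gradient (phi i))).
Context (B_le : forall k j, performed e k j ->
  opnorm (tB (trials e k j)) <= kappaB).
Context (th_low : forall k, (k <= lastit e)%N -> theta_low <= th e k).
Context (C_gt0 : 0 < C) (eps_le_h : eps ^+ 2 <= C * h N.-1).

Lemma h_antitone a b : (a <= b)%N -> h b <= h a.
Proof. by rewrite leq_eqVlt => /predU1P[->//|/h_decr/ltW]. Qed.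

Lemma cardI_le (A : {set 'I_N}) : (#|A| <= N)%N.
Proof. by rewrite -[leqRHS]card_ord max_card. Qed.

Lemma step1_h_le k : (k <= lastit e)%N -> h (Nt e k.+1) <= h #|Is e k|.
Proof.
move=> kK; have [_ [/(_ k kK)]] := exec; rewrite /step1; case: ifPn.
  by move=> _ [/andP[/ltnW lt _] _] _; apply: h_antitone.
by rewrite -leqNgt => NI -> _; apply/h_antitone/cardI_le.
Qed.

(** The parameters never increase and start below 1; hence the weights theta and 1 - theta in [Pred]
    and [Ared] are nonnegative. *)
Lemma th_le1 k : (k <= lastit e)%N -> th e k <= 1.
Proof.
have [[_ [_ [th0 _]]] [_ [_ [_ next]]]] := exec.
have [_ [/andP[_ th0_lt1] [_ [_ [_ [_ [_ [/andP[_ eta1] _]]]]]]]] := d_valid.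
elim: k => [_|k IH kK]; first by rewrite th0 ltW.
have [_ [_ [_ [-> _]]]] := next k kK.
have thk : 0 <= th e k := le_trans (ltW theta_low_gt0) (th_low (ltnW kK)).
have [/andP[_ /le_trans le] _] :=
  theta_next_bounds phi (T e k) eta1 thk (step1_h_le (ltnW kK)).
apply: le.
exact/IH/ltnW.
Qed.

Lemma Del_gt0 k j : (k <= lastit e)%N -> (j <= T e k)%N -> 0 < Del e k j.
Proof.
have [[_ [_ [_ D00]]] [_ [_ [reject next]]]] := exec.
have [_ [_ [D0 [/andP[z1 _] _]]]] := d_valid.
elim: k j => [|k IHk] j kK.
  elim: j => [_|j IHj jT]; first by rewrite D00.
  by have [_ ->] := reject _ _ kK jT; rewrite mulr_gt0 // IHj // ltnW.
elim: j => [_|j IHj jT].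
  have [_ [_ [_ [_ /andP[le _]]]]] := next k kK.
  by rewrite (lt_le_trans _ le) // IHk // ltnW.
by have [_ ->] := reject _ _ kK jT; rewrite mulr_gt0 // IHj // ltnW.
Qed.

Let kappa := L + kappaB / 2 + mu d.
(** Radii up to [delta * eps] are shown to be accepted. The first argument of the minimum serves the
    Cauchy decrease; the second makes the error [kappa] D^2 a small fraction of h(N-1). *)
Let delta :=
  Num.min Gamma (Num.sqrt ((1 - eta d) * eta d * (1 - r d) / (kappa * C))).

Lemma kappaT_ge0 : 0 <= L + kappaB / 2.
Proof. by rewrite addr_ge0 // divr_ge0 // ltW. Qed.

Lemma kappa_gt0 : 0 < kappa.
Proof. by rewrite ltr_wpDl // kappaT_ge0. Qed.

Lemma delta_gt0 : 0 < delta.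
Proof.
have [_ [_ [_ [_ [_ [_ [/andP[r0 r1] [/andP[e0 e1] _]]]]]]]] := d_valid.
rewrite lt_min Gamma_gt0 sqrtr_gt0 divr_gt0 //.
  by rewrite !mulr_gt0 // subr_gt0.
by rewrite mulr_gt0 // kappa_gt0.
Qed.

Lemma kappa_sqr_radius_le D : 0 <= D -> D <= delta * eps ->
  kappa * D ^+ 2 <= (1 - eta d) * eta d * (1 - r d) * h N.-1.
Proof.
move=> D0 Dle.
have [_ [_ [_ [_ [_ [_ [/andP[r0 r1] [/andP[e0 e1] _]]]]]]]] := d_valid.
have k0 := kappa_gt0.
set w := _ * (1 - r d); have w0 : 0 <= w.
  by rewrite /w !mulr_ge0 ?subr_ge0 // ltW.
have : D ^+ 2 <= delta ^+ 2 * eps ^+ 2.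
  by rewrite -exprMn lerXn2r ?nnegrE // mulr_ge0 // ltW // delta_gt0.
have : delta ^+ 2 <= w / (kappa * C).
  rewrite -[leRHS]sqr_sqrtr ?divr_ge0 //; last by rewrite mulr_ge0 // ltW.
  by rewrite lerXn2r ?nnegrE ?sqrtr_ge0 ?(ltW delta_gt0) // ge_min lexx orbT.
move=> dle D2.
have le1 : kappa * D ^+ 2 <= kappa * (w / (kappa * C) * eps ^+ 2).
  by rewrite ler_wpM2l ?(ltW k0) // (le_trans D2) // ler_wpM2r ?sqr_ge0.
have le2 : kappa * (w / (kappa * C) * eps ^+ 2) <=
    kappa * (w / (kappa * C) * (C * h N.-1)).
  by rewrite !ler_wpM2l ?(ltW k0) // divr_ge0 // mulr_ge0 // ltW.
apply: le_trans le1 (le_trans le2 _); rewrite le_eqVlt; apply/orP; left.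
by apply/eqP; field; rewrite !gt_eqF.
Qed.

Lemma model_error_le k j :
  performed e k j -> enorm (tp (trials e k j)) <= Del e k j ->
  favg phi (tI (trials e k j)) (xs e k + tp (trials e k j)) -
    model phi e k j (tp (trials e k j)) <= (L + kappaB / 2) * Del e k j ^+ 2.
Proof.
move=> pkj pD.
have dphi i x : differentiable (phi i) x by have [] := phi_C1 i.
have := model_error dphi (tI (trials e k j)) L_ge0 (B_le pkj) (lip pkj).
move/le_trans; apply; rewrite ler_wpM2l ?lerXn2r ?nnegrE ?enorm_ge0 //.
- exact: kappaT_ge0.
- by rewrite (le_trans _ pD) ?enorm_ge0.
Qed.

Lemma accepted_small_radius k j : performed e k j ->
  Del e k j <= delta * eps -> accepted phi d h e k j.
Proof.
move=> pkj Dle.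
have kK : (k <= lastit e)%N.
  by move: pkj; rewrite /performed; case/orP => /andP[]; [move/ltnW|move/eqP->].
have jT : (j <= T e k)%N.
  by move: pkj; rewrite /performed; case/orP => /andP[_]// /ltnW.
have D_gt0 := Del_gt0 kK jT.
have [_ [_ [_ [_ [_ [_ [/andP[r0 r1]
  [/andP[e0 e1] [/andP[t0 t1] _]]]]]]]]] := d_valid.
have [_ [/(_ k kK) s1 [/(_ k j pkj) s2 _]]] := exec.
have h1_gt0 : 0 < h N.-1 by rewrite -hN0 h_decr // prednK.
have small := kappa_sqr_radius_le (ltW D_gt0) Dle.
have th0 : 0 < th e k := lt_le_trans theta_low_gt0 (th_low kK).
have th1 := th_le1 kK.
have [/andP[tn0 tn_le] Pred_ge] :=
  theta_next_bounds phi j e1 (ltW th0) (step1_h_le kK).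
case: s2 => /andP[_ Nk1_le] [+ [nostop [_ [cauchy [pD tauC]]]]].
have -> : Del e k j `^ (1 + gamma d) = Del e k j ^+ 2.
  by rewrite gamma_eq1 -powR_mulrn ?(ltW D_gt0).
have err := model_error_le pkj pD.
set D := Del e k j in D_gt0 Dle err small pD cauchy *.
set S := tI _ in err cauchy tauC nostop Nk1_le *.
set p := tp _ in err pD tauC *.
set tn := theta_next _ _ _ _ _ _ in tn0 tn_le Pred_ge *.
move=> hD; have D2 : 0 <= D ^+ 2 := sqr_ge0 D.
(* If N_k < N, write Ared - eta Pred = (1 - eta) Pred + (Ared - Pred). Here Pred is at least eta (1
   - r) h(N-1), and Ared - Pred is at least - [kappa] D^2, so [small] concludes. *)
have [NkN|] := ltnP #|Is e k| N.
  split; first by move=> [Nk _]; move: NkN; rewrite Nk ltnn.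
  move: s1; rewrite /step1 NkN => -[_ hr].
  have hlow : h N.-1 <= h #|Is e k| by apply: h_antitone; rewrite -ltnS prednK.
  have tn1 : 0 <= 1 - tn by rewrite subr_ge0 (le_trans tn_le).
  have gap : (1 - r d) * h N.-1 <= h #|Is e k| - h (Nt e k.+1).
    have : (1 - r d) * h N.-1 <= (1 - r d) * h #|Is e k|.
      by rewrite ler_wpM2l // subr_ge0 ltW.
    lra.
  have Pge : (1 - eta d) * (eta d * ((1 - r d) * h N.-1)) <=
      (1 - eta d) * Pred phi h e k j tn.
    rewrite ler_wpM2l ?subr_ge0 ?(ltW e1) // (le_trans _ Pred_ge) //.
    by rewrite ler_wpM2l // ltW.
  move: small Pge; rewrite /Ared /Pred -/S -/p -/tn.
  set f := favg _ (Is e k) _; set m := model _ _ _ _ _ in err *.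
  set f1 := favg _ _ _ in err *.
  have m1 := ler_wpM2l tn0 err; have m2 := ler_wpM2l tn1 hD.
  (* The two errors carry weights [tn] and [1 - tn]; [m3] and [m4] supply the complementary parts
     that complete them to [kappa * D ^+ 2]. *)
  have m3 : 0 <= (1 - tn) * ((L + kappaB / 2) * D ^+ 2).
    by rewrite !mulr_ge0 // ?kappaT_ge0 // ltW.
  have m4 : 0 <= tn * (mu d * D ^+ 2) by rewrite !mulr_ge0 // ltW.
  rewrite /kappa; lra.
move=> NNk; have Nk : #|Is e k| = N by apply/eqP; rewrite eqn_leq NNk cardI_le.
have full (A : {set 'I_N}) : #|A| = N -> A = [set: 'I_N]%SET.
  move=> AN; apply/eqP.
  by rewrite eqEcard finset.subsetT cardsT card_ord AN leqnn.
have NtN : Nt e k.+1 = N by move: s1; rewrite /step1 Nk ltnn.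
move: hD; rewrite NtN hN0 subr0 => hD.
(* A proper sample would give h(N-1) <= h(N_{k+1}) <= mu D^2 <= [kappa] D^2 < h(N-1). *)
have Nk1 : #|S| = N.
  apply/eqP; rewrite eqn_leq cardI_le leqNgt; apply/negP => ltN.
  have : h N.-1 <= h #|S| by apply: h_antitone; rewrite -ltnS prednK.
  have : (1 - eta d) * eta d * (1 - r d) * h N.-1 < h N.-1.
    rewrite gtr_pMl // mulr_ilt1 ?mulr_ge0 ?subr_ge0 ?mulr_ilt1 //;
      rewrite ?(ltW e0) ?(ltW e1) ?(ltW r1) //; lra.
  have : 0 <= (L + kappaB / 2) * D ^+ 2 by rewrite mulr_ge0 // kappaT_ge0.
  by move: small; rewrite /kappa; lra.
have DG : D <= Gamma * eps.
  by rewrite (le_trans Dle) // ler_wpM2r ?(ltW eps_gt0) // ge_min lexx.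
have g_gt : eps < enorm (gradient (favg phi S) (xs e k)).
  by rewrite ltNge; apply/negP => g_le; apply: nostop.
have Dg : D * (1 + kappaB) <= enorm (gradient (favg phi S) (xs e k)).
  apply: le_trans (ltW g_gt); have := ler_wpM2r (ltW eps_gt0) Gamma_le_beta.
  have : D * (1 + kappaB) <= Gamma * eps * (1 + kappaB).
    by rewrite ler_wpM2r // addr_ge0 // ltW.
  lra.
have decr := cauchy_decrease (B_le pkj) D_gt0 Dg cauchy.
(* Both samples are the whole index set, so f_{N_k}(x_k) is the value of the model at 0. *)
have Isk : Is e k = S by rewrite (full _ Nk) (full _ Nk1).
have m0 : model phi e k j 0 = favg phi S (xs e k) by apply: quad_model0.
rewrite m0 in tauC.
have b_ge : tau d * (D * eps / 2) <=
    favg phi S (xs e k) - model phi e k j p.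
  apply: le_trans tauC; rewrite ler_wpM2l ?(ltW t0) // (le_trans _ decr) //.
  by rewrite ler_wpM2r // ler_wpM2l ?(ltW D_gt0) // (ltW g_gt).
have b_ge0 : 0 <= favg phi S (xs e k) - model phi e k j p.
  by apply: le_trans b_ge; rewrite mulr_ge0 ?divr_ge0 ?mulr_ge0 // ltW.
split; first by move=> [_ [+ _]]; rewrite -/S Nk1 ltnn.
(* All infeasibility terms vanish, so the test of Step 4 reads Pred >= 0 and leaves theta_k
   unchanged. The factor theta_k then cancels from the acceptance test. *)
rewrite -/tn; have -> : tn = th e k.
  rewrite /tn /theta_next NtN Nk hN0 subr0 mulr0 ifT //.
  by rewrite /Pred NtN Nk hN0 subr0 mulr0 addr0 Isk mulr_ge0 // (ltW th0).
rewrite /Ared /Pred NtN Nk -/S -/p Nk1 hN0 subr0 !mulr0 !addr0 Isk mulrCA.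
rewrite ler_wpM2l ?(ltW th0) //.
have kD : kappa * D ^+ 2 <= kappa * (D * (Gamma * eps)).
  rewrite ler_wpM2l ?(ltW kappa_gt0) //.
  by rewrite expr2 ler_wpM2l // ltW.
have De : 0 <= D * eps by rewrite mulr_ge0 // ltW.
have kG := ler_wpM2r De Gamma_le_theta.
(* With [theta_low <= 1], the chain is err <= [kappa] D^2 <= [kappa] D Gamma eps <= (1 - eta) tau D
   eps / 2 <= (1 - eta) (f - m). *)
have low1 : tau d * theta_low * (1 - eta d) * (D * eps) <=
    tau d * (1 - eta d) * (D * eps).
  rewrite ler_wpM2r // ler_wpM2r ?subr_ge0 ?(ltW e1) // ler_piMr ?(ltW t0) //.
  by rewrite (le_trans (th_low kK)).
have b1 := ler_wpM2l (_ : 0 <= 1 - eta d) b_ge.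
move: b1 kD; rewrite subr_ge0 => /(_ (ltW e1)) b1; rewrite /kappa => kD.
have mD : 0 <= mu d * D ^+ 2 by rewrite mulr_ge0 // ltW.
move: err b1.
set f := favg phi S (xs e k); set m := model _ _ _ _ p; set f1 := favg _ _ _.
lra.
Qed.

(** The factor [zeta1 d] pays for one last reduction: a rejected radius exceeds [delta * eps], and
    its successor is [zeta1 d] times it. *)
Let low := zeta1 d * delta * eps.

Lemma Del_ge k j : zeta1 d * (Gamma * eps) <= Delta0 d ->
  (k <= lastit e)%N -> (j <= T e k)%N -> low <= Del e k j.
Proof.
move=> D0_ge.
have [[_ [_ [_ D00]]] [_ [_ [reject next]]]] := exec.
have [_ [_ [D0 [/andP[z0 z1] _]]]] := d_valid.
have stepj k' j' : (k' <= lastit e)%N -> (j' < T e k')%N ->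
    low <= Del e k' j'.+1.
  move=> kK jT; have [nacc ->] := reject _ _ kK jT.
  rewrite /low -mulrA ler_wpM2l ?(ltW z0) // leNgt; apply/negP => lt.
  apply: nacc; apply: accepted_small_radius; last exact: ltW.
  rewrite /performed; move: kK; rewrite leq_eqVlt => /orP[->|->].
    by rewrite jT orbT.
  by rewrite (ltnW jT).
elim: k j => [|k IHk] [|j] kK jT; try exact: stepj.
  rewrite D00 (le_trans _ D0_ge) // /low -mulrA ler_wpM2l ?(ltW z0) //.
  by rewrite ler_wpM2r ?(ltW eps_gt0) // ge_min lexx.
have [_ [_ [_ [_ /andP[le _]]]]] := next k kK.
by rewrite (le_trans _ le) // IHk // ltnW.
Qed.

Lemma Del_le k j : (k <= lastit e)%N -> (j <= T e k)%N ->
  Del e k j <=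
    zeta2 d ^+ k * zeta1 d ^+ (\sum_(i < k) T e i + j) * Delta0 d.
Proof.
have [[_ [_ [_ D00]]] [_ [_ [reject next]]]] := exec.
have [_ [_ [D0 [/andP[z0 z1] [z2 _]]]]] := d_valid.
have stepj k' (kK : (k' <= lastit e)%N) :
    Del e k' 0 <= zeta2 d ^+ k' * zeta1 d ^+ (\sum_(i < k') T e i) * Delta0 d ->
    forall j', (j' <= T e k')%N -> Del e k' j' <=
      zeta2 d ^+ k' * zeta1 d ^+ (\sum_(i < k') T e i + j') * Delta0 d.
  move=> start; elim=> [_|j' IHj jT]; first by rewrite addn0.
  have [_ ->] := reject _ _ kK jT; rewrite addnS exprS.
  have := ler_wpM2l (ltW z0) (IHj (ltnW jT)).
  by rewrite -!mulrA [zeta1 d * (zeta2 d ^+ _ * _)]mulrCA.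
elim: k j => [|k IHk] j kK; apply: stepj => //.
  by rewrite big_ord0 !expr0 !mul1r D00.
have [_ [_ [_ [_ /andP[_ le]]]]] := next k kK.
apply: (le_trans le); rewrite big_ord_recr exprS -!mulrA.
by rewrite ler_wpM2l ?mulrA ?IHk ?(ltnW kK) // ltW // (lt_trans ltr01).
Qed.

End Radius.

(** * From radius bounds to the evaluation count *)

(** Dividing the logarithm of the radius inequality by ln z1 < 0 bounds [S]. Since K + 1 <= X + 2,
    the factor z1^-2 inside the logarithm absorbs the 2, and [z2] absorbs the enlargement left over
    from K <= X + 1. *)
Lemma evaluations_bound (R : realType) (z1 z2 D0 c eps X : R) (K S : nat) :
  0 < z1 < 1 -> 1 < z2 -> 0 < D0 -> 0 < c -> 0 < eps ->
  c * eps <= z2 ^+ K * z1 ^+ S * D0 -> K%:R <= X + 1 ->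
  K.+1%:R + S%:R <=
    X * (1 - ln z2 / ln z1) - ln (D0 / c * z2 / z1 ^+ 2 * eps^-1) / ln z1.
Proof.
move=> /andP[z10 z11] z21 D00 c0 eps0 radius KX.
have z20 : 0 < z2 := lt_trans ltr01 z21.
have lz1 : ln z1 < 0 by rewrite ln_lt0 // z10.
have lz2 : 0 < ln z2 by rewrite ln_gt0.
have prod_gt0 : 0 < z2 ^+ K * z1 ^+ S * D0 by rewrite !mulr_gt0 ?exprn_gt0.
have : ln (c * eps) <= ln (z2 ^+ K * z1 ^+ S * D0).
  by rewrite ler_ln ?posrE // mulr_gt0.
rewrite !lnM ?posrE ?mulr_gt0 ?invr_gt0 ?exprn_gt0 //.
rewrite !lnV ?posrE ?exprn_gt0 // !lnXn //.
set x := ln z1 in lz1 *; set y := ln z2 in lz2 *.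
rewrite -[x *+ S]mulr_natl -[y *+ K]mulr_natl -[x *+ 2]mulr_natl => logs.
rewrite -natr1 -(ler_nM2r lz1) mulrBl divfK ?lt_eqF //.
rewrite -mulrA mulrBl divfK ?lt_eqF // mul1r.
have := ler_wpM2r (ltW lz2) KX.
have := ler_wnM2r (ltW lz1) KX.
lra.
Qed.

Theorem corollary5p5 (R : realType) (n N : nat)
    (phi : 'I_N -> 'cV[R]_n -> R) (d : iretr_data R n)
    (Omega : set 'cV[R]_n) (L kappaB theta_low Gamma C nu4 : R)
    (n_ge1 : (1 <= n)%N) (N_ge1 : (1 <= N)%N)
    (phi_C1 : forall i, C1 (phi i))
    (d_valid : valid_data N d) (gamma_eq1 : gamma d = 1) (mu_gt0 : 0 < mu d)
    (Omega_compact : compact Omega)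
    (L_ge0 : 0 <= L) (kappaB_gt0 : 0 < kappaB)
    (theta_low_gt0 : 0 < theta_low)
    (Gamma_gt0 : 0 < Gamma)
    (Gamma_le : Gamma <= Num.min (1 / (1 + kappaB))
       (tau d * theta_low * (1 - eta d) / (2 * (L + kappaB / 2 + mu d))))
    (nu4_gt0 : 0 < nu4) :
  exists2 nu5 : R, 0 < nu5 &
  forall (eps : R) (h : nat -> R) (e : execution R n N),
    0 < eps ->
    is_execution phi d eps h e ->
    (forall a b : nat, (a < b)%N -> h b < h a) ->
    0 < h 1%N -> h N = 0 ->
    (forall k, (k <= lastit e)%N -> Omega (xs e k)) ->
    (forall k j, performed e k j -> forall i,
       elipschitz_on L (segment (xs e k) (xs e k + tp (trials e k j)))
         (gradient (phi i))) ->
    (forall k j, performed e k j -> opnorm (tB (trials e k j)) <= kappaB) ->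
    (forall k, (k <= lastit e)%N -> theta_low <= th e k) ->
    (forall k, (k < lastit e)%N -> #|Is e k| = N ->
       eps < enorm (gradient (favg phi (Is e k.+1)) (xs e k)) ->
       Num.min (Num.min (zeta1 d * Num.sqrt (h N.-1 / mu d))
                        (zeta1 d * Gamma * eps)) (Delta0 d)
       <= Del e k (T e k)) ->
    (h N.-1)^-1 <= C * eps ^- 2 ->
    zeta1 d * Num.max (Gamma * eps) (Num.sqrt (h N.-1 / mu d)) <= Delta0 d ->
    (iterations e)%:Z <= Num.ceil (nu4 * eps ^- 2) + 1 ->
    (evaluations e)%:Z <=
      Num.ceil (nu4 * eps ^- 2 * (1 - ln (zeta2 d) / ln (zeta1 d))
                - ln (nu5 * eps^-1) / ln (zeta1 d)).
Proof.
have [_ [_ [D0 [/andP[z10 z11] [z2 _]]]]] := d_valid.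
pose kappa := L + kappaB / 2 + mu d.
have kappa0 : 0 < kappa by rewrite /kappa; lra.
(* [Num.max C 1] replaces [C], whose sign is not prescribed, to keep the divisor positive. *)
pose delta := Num.min Gamma
  (Num.sqrt ((1 - eta d) * eta d * (1 - r d) / (kappa * Num.max C 1))).
have maxC0 : 0 < Num.max C 1 by rewrite lt_max ltr01 orbT.
have [Gbeta Gtheta] : Gamma * (1 + kappaB) <= 1 /\
    Gamma * (2 * kappa) <= tau d * theta_low * (1 - eta d).
  move: Gamma_le; rewrite le_min => /andP[]; rewrite !ler_pdivlMr ?mulr_gt0 //.
  by lra.
have c0 : 0 < zeta1 d * delta.
  by rewrite mulr_gt0 // (delta_gt0 d_valid).
(* The ratio of the initial radius to the lower bound (per unit of [eps]), times the correction from
   [evaluations_bound]; it is chosen before [eps], [h] and [e]. *)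
exists (Delta0 d / (zeta1 d * delta) * zeta2 d / zeta1 d ^+ 2).
  by rewrite !mulr_gt0 ?invr_gt0 ?exprn_gt0 // (lt_trans ltr01).
move=> eps h e eps0 exec hdecr h1 hN0 _ lip BK thlow _ hC D0ge iter.
have hlow : 0 < h N.-1 by rewrite -hN0 hdecr // prednK.
have epsh : eps ^+ 2 <= Num.max C 1 * h N.-1.
  apply: (@le_trans _ _ (C * h N.-1)).
    by move: hC; rewrite ler_pdivlMr ?exprn_gt0 // mulrC ler_pdivrMr.
  by rewrite ler_wpM2r ?(ltW hlow) // le_max lexx.
have D0G : zeta1 d * (Gamma * eps) <= Delta0 d.
  by apply: le_trans D0ge; rewrite ler_wpM2l ?(ltW z10) // le_max lexx.
set K := lastit e in exec lip BK thlow *.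
have ge := Del_ge N_ge1 phi_C1 d_valid gamma_eq1 mu_gt0 L_ge0 kappaB_gt0
  theta_low_gt0 Gamma_gt0 Gbeta Gtheta eps0 exec hdecr hN0 lip BK thlow maxC0
  epsh D0G (leqnn K) (leqnn (T e K)).
have le := Del_le d_valid exec (leqnn K) (leqnn (T e K)).
(* The iteration count is K + 1, so the +1 outside the ceiling cancels; the +1 here comes from the
   ceiling itself. *)
have {}iter : K%:R <= nu4 * eps ^- 2 + 1.
  have : (K%:Z <= Num.ceil (nu4 * eps ^- 2))%R.
    by move: iter; rewrite /iterations -/K intS addrC lerD2r.
  rewrite -(ler_int R) => /le_trans; apply.
  have /andP[+ _] := ceil_itv (nu4 * eps ^- 2).
  by rewrite intrB ltrBlDr => /ltW.
rewrite -(ler_int R); apply: le_trans (ceil_ge _).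
rewrite /evaluations big_split sum1_card card_ord /= -pmulrn natrD.
apply: evaluations_bound => //; rewrite ?z10 //.
(* The reductions of the unfinished iteration K complete the exponent in [Del_le] to the full sum of
   the [T e i]. *)
by rewrite big_ord_recr /=; apply: le_trans ge le.
Qed.
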